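(* Let $g\ge 1$ and fix a CG set $\mathcal{S}$ for $\pi=\pi_1(\Sigma_{g,1},p)$, with associated ''basepoint'' marked linear chord diagram $G=G_{\mathcal{S}}$ and associated energy function $\lVert\cdot\rVert$. Given any marked linear chord diagram $G_0$ (that is, $G_0=G_{\mathcal{X}}$ for an arbitrary CG set $\mathcal{X}$ for $\pi$), there exists a finite sequence of chord slides $$G_0\to G_1\to\cdots\to G_k,\qquad \lVert G_i\rVert<\lVert G_{i-1}\rVert\ \text{ for all } 1\le i\le k,$$ with $G_k=G$.
   Context: Surface group. $\Sigma_{g,1}$ is a compact connected oriented surface of genus $g$ with one boundary component, $p\in\partial\Sigma_{g,1}$, $\pi=\pi_1(\Sigma_{g,1},p)$, and $\partial\Sigma_{g,1}$ also denotes the element of $\pi$ represented by the boundary. Algebraically, $\pi$ is the free group on $\alpha_1,\beta_1,\dots,\alpha_g,\beta_g$ and $\partial\Sigma_{g,1}=\prod_{i=1}^g[\alpha_i,\beta_i]$, where $[x,y]=xy\bar x\bar y$ and $\bar x$ denotes the inverse of $x$. CG sets. For an ordered set $\mathcal{X}=\{x_1,\dots,x_{2g}\}$ of $2g$ generators of $\pi$ (necessarily a free basis), the letters of $\mathcal{X}$ are the $4g$ elements $x_i,\bar x_i$. $\mathcal{X}$ is a combinatorial generating set (CG set) if $\partial\Sigma_{g,1}$ can be written as a reduced word in the letters of $\mathcal{X}$ using each letter exactly once. Then $\mathcal{C}_{\mathcal{X}}=(c_1,\dots,c_{4g})$ denotes the unique ordering of the letters with $c_1c_2\cdots c_{4g}=\overline{\partial\Sigma_{g,1}}$;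 the $c_j$ are called the chord ends of $\mathcal{X}$. Two CG sets are equivalent if they have the same set of letters (equivalently, the same sequence of chord ends). Marked linear chord diagrams. $G_{\mathcal{X}}$ is the linear chord diagram with $4g$ chord ends at the points $1,\dots,4g$ of the real line, points $j$ and $k$ being joined by a chord iff $c_k=\bar c_j$, together with the labelling of the point $j$ by $c_j\in\pi$. Thus $G_{\mathcal{X}}$ is determined by the sequence $\mathcal{C}_{\mathcal{X}}$, and $G_{\mathcal{X}}=G_{\mathcal{Y}}$ iff $\mathcal{X},\mathcal{Y}$ are equivalent. Chord slides. For $j>1$, the slide of $c_j$ to the left produces from $(c_1,\dots,c_{4g})$ the sequence obtained, with $d=c_{j-1}c_j$, by deleting the entry $c_j$, replacing the entry $c_{j-1}$ by $d$, and replacing the entry $\bar c_{j-1}$ by the two consecutive entries $c_j,\bar d$. For $j<4g$, the slide of $c_j$ to the right produces the sequence obtained, with $d=c_jc_{j+1}$, by deleting the entry $c_j$, replacing the entry $c_{j+1}$ by $d$, and replacing the entry $\bar c_{j+1}$ by the two consecutive entries $\bar d,c_j$. The result is the sequence of chord ends of a CG set (well defined up to equivalence), hence a new marked linear chord diagram. Length and energy. With $\mathcal{S}$ fixed, let $\mathcal{C}_{\mathcal{S}}=(\sigma_1,\dots,\sigma_{4g})$. For $w\in\pi$, $|w|$ is the word length of $w$ with respect to $\mathcal{S}$. If $w=\sigma_{j_1}\sigma_{j_2}\cdots\sigma_{j_k}$ is the reduced word of $w$ in the letters of $\mathcal{S}$, its energy is $\lVert w\rVert=\sum_{i=1}^k(4g+1)^{k-i}j_i$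 (so $\lVert\sigma_j\rVert=j$ and $\lVert \mathrm{id}\rVert=0$). For a CG set $\mathcal{X}$ with chord ends $c_1,\dots,c_{4g}$, $\lVert G_{\mathcal{X}}\rVert=\lVert\mathcal{X}\rVert=\sum_{j=1}^{4g}\lVert c_j\rVert$. *)

(* Defs.v *)
From HB Require Import structures.
From mathcomp Require Import all_boot.

Set Implicit Arguments.
Unset Strict Implicit.
Unset Printing Implicit Defensive.

Local Open Scope group_scope.

(* A formal letter is a pair (x, b), standing for x if b = false and for the  *)
(* inverse of x if b = true.                                                  *)
Definition letter_inv (T : Type) (l : T * bool) : T * bool := (l.1, ~~ l.2).

Definition reduced (T : eqType) (w : seq (T * bool)) : bool :=
  sorted (fun l m => m != letter_inv l) w.

Definition letter_eval (T : Type) (G : groupType) (f : T -> G) (l : T * bool)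
  : G := if l.2 then (f l.1)^-1 else f l.1.

Definition word_eval (T : Type) (G : groupType) (f : T -> G)
  (w : seq (T * bool)) : G := \prod_(l <- w) letter_eval f l.

Record free_group (T : choiceType) := FreeGroup {
  fg_word :> seq (T * bool);
  fg_reduced : reduced fg_word
}.

HB.instance Definition _ (T : choiceType) := [isSub for @fg_word T].
HB.instance Definition _ (T : choiceType) := [Choice of free_group T by <:].

Section FreeGroup.
Variable T : choiceType.
Implicit Types (l m : T * bool) (u v w : seq (T * bool)).

Definition push l w : seq (T * bool) :=
  if w is m :: w' then if m == letter_inv l then w' else l :: w else [:: l].

Lemma letter_invK : involutive (@letter_inv T).
Proof. by case=> x b; rewrite /letter_inv /= negbK. Qed.

Lemma reduced_push l w : reduced w -> reduced (push l w).
Proof.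
case: w => [|m w] //=; case: eqP => [_|/eqP ne] /= pw.
  exact: path_sorted pw.
by rewrite ne.
Qed.

Lemma reduced_act u w : reduced w -> reduced (foldr push w u).
Proof. by move=> rw; elim: u => //= l u; apply: reduced_push. Qed.

Lemma pushK l w : reduced w -> push (letter_inv l) (push l w) = w.
Proof.
rewrite /push; case: w => [|m w] /=; first by rewrite letter_invK eqxx.
case: (m =P letter_inv l) => [-> | _ _]; last by rewrite letter_invK eqxx.
by case: w => [|k w] //= /andP[/negPf-> _].
Qed.

Lemma act_push l u w :
  reduced w -> foldr push w (push l u) = push l (foldr push w u).
Proof.
move=> rw; case: u => [|m u] //=; case: eqP => //= ->.
by rewrite -{1}(letter_invK l) pushK // reduced_act.
Qed.

Lemma act_act u v w :
  reduced w -> foldr push w (foldr push v u) = foldr push (foldr push w v) u.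
Proof. by move=> rw; elim: u => //= l u IH; rewrite act_push ?IH. Qed.

Lemma act_nil u : reduced u -> foldr push [::] u = u.
Proof.
elim: u => //= l u IH pu; rewrite IH; last exact: path_sorted pu.
by case: u pu {IH} => [|m u] //= /andP[/negPf-> _].
Qed.

Definition fg_one : free_group T := @FreeGroup T [::] isT.

Definition fg_mul (u v : free_group T) : free_group T :=
  FreeGroup (reduced_act u (fg_reduced v)).

Lemma reduced_inv w : reduced w -> reduced (rev (map (@letter_inv T) w)).
Proof.
rewrite /reduced rev_sorted sorted_map; apply: sub_sorted => l m /=.
by rewrite letter_invK; apply: contraNneq => ->.
Qed.

Definition fg_inv (u : free_group T) : free_group T :=
  FreeGroup (reduced_inv (fg_reduced u)).

Lemma fg_mulA : associative fg_mul.
Proof. by move=> u v w; apply: val_inj; rewrite /= act_act // (fg_reduced w). Qed.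

Lemma fg_mul1 : left_id fg_one fg_mul.
Proof. by move=> u; apply: val_inj. Qed.

Lemma fg_mulr1 : right_id fg_one fg_mul.
Proof. by move=> u; apply: val_inj; rewrite /= act_nil // (fg_reduced u). Qed.

Lemma fg_mulV : left_inverse fg_one fg_inv fg_mul.
Proof.
case=> u ru; apply: val_inj => /=; elim: u ru => //= l u IH pu.
rewrite rev_cons -cats1 foldr_cat /= letter_invK eqxx.
by apply: IH; apply: path_sorted pu.
Qed.

Lemma fg_invK : involutive fg_inv.
Proof.
move=> u; apply: val_inj; rewrite /= map_rev revK -map_comp.
by rewrite map_id_in // => l _ /=; rewrite letter_invK.
Qed.

Lemma fg_mulrV : right_inverse fg_one fg_inv fg_mul.
Proof. by move=> u; rewrite -{1}(fg_invK u) fg_mulV. Qed.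

Definition fg_gen (x : T) : free_group T := @FreeGroup T [:: (x, false)] isT.

End FreeGroup.

HB.instance Definition _ (T : choiceType) :=
  isGroup.Build (free_group T) (@fg_mulA T) (@fg_mul1 T) (@fg_mulr1 T)
    (@fg_mulV T) (@fg_mulrV T).

Definition surface_group (g : nat) : groupType :=
  free_group ('I_g + 'I_g)%type.

Definition alpha g (i : 'I_g) : surface_group g := fg_gen (inl i).
Definition beta g (i : 'I_g) : surface_group g := fg_gen (inr i).

(* The commutators are x y x^-1 y^-1, not MathComp's [~ x, y].                *)
Definition boundary (g : nat) : surface_group g :=
  \prod_(i < g) (alpha i * beta i * (alpha i)^-1 * (beta i)^-1).

(* Free groups of finite rank are Hopfian, so 2g generators form a free basis *)
(* and the 4g letters cg_gen i, (cg_gen i)^-1 are pairwise distinct. This also *)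
(* makes the choices in chord_ends and reduced_word below unique.             *)
Record CG_set (g : nat) := CGSet {
  cg_gen :> 'I_(2 * g) -> surface_group g;
  cg_generates : forall x, exists w, word_eval cg_gen w = x;
  cg_boundary : exists w : seq ('I_(2 * g) * bool),
    [/\ reduced w, forall l, count_mem l w = 1%N
      & word_eval cg_gen w = boundary g]
}.

Section CGSets.
Variable g : nat.
Implicit Types X S : CG_set g.

Definition letters X : seq (surface_group g) :=
  [seq letter_eval X l | l <- enum {: 'I_(2 * g) * bool}].

Lemma letter_eval_inv (T : Type) (G : groupType) (f : T -> G) l :
  letter_eval f (letter_inv l) = (letter_eval f l)^-1.
Proof. by case: l => x [] //=; rewrite /letter_eval /= invgK. Qed.

Lemma word_eval_inv (T : Type) (G : groupType) (f : T -> G) w :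
  word_eval f (rev (map (@letter_inv T) w)) = (word_eval f w)^-1.
Proof.
rewrite /word_eval; elim: w => [|l w IH] /=; first by rewrite !big_nil invg1.
rewrite rev_cons -cats1 big_cat /= IH big_cons big_nil mulg1 big_cons invgM.
by rewrite letter_eval_inv.
Qed.

Lemma chord_ends_exist X : exists c : (4 * g).-tuple (surface_group g),
  perm_eq c (letters X) && (\prod_(x <- c) x == (boundary g)^-1).
Proof.
have [w [_ cw ew]] := cg_boundary X.
pose v := rev (map (@letter_inv _) w).
have pv : perm_eq v (enum {: 'I_(2 * g) * bool}).
  apply/allP => l _ /=; rewrite /v count_rev count_map.
  rewrite (count_uniq_mem _ (enum_uniq _)) mem_enum inE /=.
  apply/eqP; rewrite -[RHS](cw (letter_inv l)); apply: eq_count => m /=.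
  by rewrite (can2_eq (@letter_invK _) (@letter_invK _)).
have sv : size (map (letter_eval X) v) == (4 * g)%N.
  rewrite size_map (perm_size pv) -cardE card_prod card_ord card_bool.
  by rewrite mulnAC.
exists (Tuple sv); rewrite /= perm_map //= big_map.
by rewrite -/(word_eval X v) word_eval_inv ew.
Qed.

Definition chord_ends X : (4 * g).-tuple (surface_group g) :=
  xchoose (chord_ends_exist X).

(* Words in the letters of S, encoded by the positions of the letters in      *)
(* chord_ends S; positions are 0-based here and in the slides below.          *)
Definition is_reduced_word S (x : surface_group g) (s : seq 'I_(4 * g)) : bool :=
  let sigma := tnth (chord_ends S) in
  sorted (fun j k => sigma k != (sigma j)^-1) s && (\prod_(j <- s) sigma j == x).

Lemma reduced_word_exists S x : exists s, is_reduced_word S x s.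
Proof.
have [w <-] := cg_generates S x; rewrite /word_eval.
elim: w => [|l w [s /andP[rs /eqP es]]].
  by exists [::]; rewrite /is_reduced_word !big_nil eqxx.
have /andP[pc _] := xchooseP (chord_ends_exist S).
have: letter_eval S l \in chord_ends S.
  by rewrite (perm_mem pc) map_f // mem_enum.
case/tnthP=> j ej; rewrite big_cons -es ej.
case: s rs {es} => [|k s] rs.
  by exists [:: j]; rewrite /is_reduced_word !big_cons !big_nil /=.
have [ek|ne] := eqVneq (tnth (chord_ends S) k) (tnth (chord_ends S) j)^-1.
  exists s; rewrite /is_reduced_word (path_sorted rs) /=.
  by rewrite big_cons ek mulgA mulgV mul1g.
exists [:: j, k & s]; rewrite /is_reduced_word !big_cons eqxx andbT /=.
by rewrite ne.
Qed.

Definition reduced_word S x : seq 'I_(4 * g) :=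
  xchoose (reduced_word_exists S x).

(* The 0-based i and s_i account for the two successors.                      *)
Definition energy S x : nat :=
  let s := reduced_word S x in
  (\sum_(i < size s) (4 * g + 1) ^ (size s - i.+1) * (tnth (in_tuple s) i).+1)%N.

Record marked_diagram := MarkedDiagram {
  chords : {set 'I_(4 * g) * 'I_(4 * g)};
  marking : (4 * g).-tuple (surface_group g)
}.

Definition diagram X : marked_diagram :=
  let c := chord_ends X in
  MarkedDiagram [set jk | tnth c jk.2 == (tnth c jk.1)^-1] c.

Definition diagram_energy S (G : marked_diagram) : nat :=
  (\sum_(j < 4 * g) energy S (tnth (marking G) j))%N.

Definition slide_left (j : nat) (c : seq (surface_group g)) :=
  let d := nth 1 c j.-1 * nth 1 c j in
  flatten [seq if i == j then [::]
               else if i == j.-1 then [:: d]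
               else if nth 1 c i == (nth 1 c j.-1)^-1 then [:: nth 1 c j; d^-1]
               else [:: nth 1 c i] | i <- iota 0 (size c)].

Definition slide_right (j : nat) (c : seq (surface_group g)) :=
  let d := nth 1 c j * nth 1 c j.+1 in
  flatten [seq if i == j then [::]
               else if i == j.+1 then [:: d]
               else if nth 1 c i == (nth 1 c j.+1)^-1 then [:: d^-1; nth 1 c j]
               else [:: nth 1 c i] | i <- iota 0 (size c)].

Definition chord_slide (G G' : marked_diagram) : Prop :=
  exists X Y : CG_set g, [/\ G = diagram X, G' = diagram Y &
    exists j, ((0 < j < 4 * g)%N /\
                 chord_ends Y = slide_left j (chord_ends X) :> seq _)
           \/ ((j.+1 < 4 * g)%N /\
                 chord_ends Y = slide_right j (chord_ends X) :> seq _)].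

End CGSets.

(* Main.v *)
From HB Require Import structures.
Require Import Defs.
From mathcomp Require Import all_boot fingroup perm zify.

(** Why a diagram other than the one of [S] always admits an energy decreasing
    slide; since energies are natural numbers, iterating then ends at [S].

    Sliding one of two neighbouring chord ends [a], [b] over the other replaces
    one of them, say [x], by [a * b] (and [x^-1] by the inverse of [a * b]), so
    it changes the total energy by the difference of the symmetrised energies
    of [a * b] and [x], where the symmetrised energy of [w] is the energy of
    [w] plus that of [w^-1].  Energy compares words first by length and then
    lexicographically.  Suppose that no slide decreases it, and write the chord
    ends as reduced words [c i] in the letters [sigma i] of [S].

    - Lengths alone show that in each product [c i * c i.+1] the cancelled part
      [p i.+1] is at most half of either factor ([cancelled_half]).
    - If a factor were wholly cancelled, half by its left and half by its right
      neighbour, then exchanging one half for the other in one of these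
      neighbours would decrease the energy ([exchange_left],
      [exchange_right]).  So each [c i] keeps a nonempty middle part.  The
      concatenation of the [4 * g] middles is the reduced word of the inverse
      boundary, which is [sigma 0 ... sigma (4 * g - 1)]; hence each middle is
      a single letter and [c i = p i * sigma i * (p i.+1)^-1].
    - The same exchange argument gives a strict inequality whenever the lengths
      of [p i] and [p i.+1] differ.  Comparing the inequalities of two inverse
      chord ends [c k] and [c i] forces [sigma k = (sigma i)^-1] and
      [p k = p i.+1] ([paired_steps]).  So [p] is a function on the vertices of
      the [4 * g]-gon with edges [sigma i] glued in inverse pairs.
    - The glued polygon is a closed surface of genus [g] with one vertex, hence
      all [p i] equal [p 0 = 1] and [c i = sigma i].

    The last point is proved algebraically ([one_vertex]).  A function on the
    vertices has a coboundary, which is a homomorphism [delta] from the free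
    group, and twisting a homomorphism by such a function does not change its
    value on the boundary element.  In the Heisenberg group over F_2 this says
    that [delta] is orthogonal to every homomorphism to F_2 for the
    intersection form of the standard basis, so [delta] vanishes.

    All this needs that the [2 * g] generators of a CG set form a free basis
    ([generators_free]).  Homomorphisms to a finite group [H] are determined by
    their values on any generating set, and there are as many of them as
    functions from [2 * g] generators to [H]; hence each such function extends
    to a homomorphism ([hom_extension]), and residual finiteness of the free
    group on these generators concludes. *)

Set Implicit Arguments.
Unset Strict Implicit.
Unset Printing Implicit Defensive.

Local Open Scope group_scope.

(** * Words and homomorphisms from free groups *)

Section Words.
Variables (T : eqType) (G : groupType) (f : T -> G).
Implicit Types (l m : T * bool) (u v w : seq (T * bool)).

Lemma word_eval_cons l w : word_eval f (l :: w) = letter_eval f l * word_eval f w.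
Proof. by rewrite /word_eval big_cons. Qed.

Lemma word_eval_cat u v : word_eval f (u ++ v) = word_eval f u * word_eval f v.
Proof. by rewrite /word_eval big_cat. Qed.

Lemma word_eval1 l : word_eval f [:: l] = letter_eval f l.
Proof. by rewrite /word_eval big_seq1. Qed.

End Words.

Definition word_inv (T : Type) (w : seq (T * bool)) := rev (map (@letter_inv T) w).

Section WordInv.
Variable T : choiceType.
Implicit Types (l m : T * bool) (u v w : seq (T * bool)).

Lemma size_word_inv w : size (word_inv w) = size w.
Proof. by rewrite size_rev size_map. Qed.

Lemma word_inv_cat u v : word_inv (u ++ v) = word_inv v ++ word_inv u.
Proof. by rewrite /word_inv map_cat rev_cat. Qed.

Lemma word_inv_cons l w : word_inv (l :: w) = rcons (word_inv w) (letter_inv l).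
Proof. by rewrite /word_inv /= rev_cons. Qed.

Lemma word_invK : involutive (@word_inv T).
Proof.
move=> w; rewrite /word_inv map_rev revK -map_comp map_id_in // => l _ /=.
exact: letter_invK.
Qed.

Lemma word_inv_rcons l w : word_inv (rcons w l) = letter_inv l :: word_inv w.
Proof. by rewrite -cats1 word_inv_cat. Qed.

Lemma letter_inv_neq l : letter_inv l != l.
Proof. by case: l => x []; rewrite /letter_inv /eq_op /= eqxx. Qed.

Lemma eq_letter_inv l m : (l == letter_inv m) = (letter_inv l == m).
Proof. by apply/eqP/eqP => [->|<-]; rewrite letter_invK. Qed.

Lemma reduced_cat_middle u v x : reduced (rcons u x) -> reduced (x :: v) ->
  reduced (u ++ x :: v).
Proof.
case: u => [//|y u]; rewrite /reduced /= rcons_path cat_path => /andP[-> /=] -> /= ->.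
by [].
Qed.

Lemma reduced_catl u v : reduced (u ++ v) -> reduced u.
Proof. by rewrite /reduced; case: u => [|x u] //=; rewrite cat_path => /andP[]. Qed.

Lemma reduced_catr u v : reduced (u ++ v) -> reduced v.
Proof.
rewrite /reduced; case: u => [|x u] //=; rewrite cat_path => /andP[_].
exact: path_sorted.
Qed.

Lemma reduced_word_inv w : reduced w -> reduced (word_inv w).
Proof. exact: reduced_inv. Qed.

Lemma reduced_cat_rcons u v l m :
  reduced (rcons u l ++ m :: v) =
    [&& reduced (rcons u l), m != letter_inv l & reduced (m :: v)].
Proof.
rewrite /reduced; case: u => [|x u] //=.
by rewrite cat_path /= last_rcons rcons_path.
Qed.

(** Maximal cancellation in a product of two reduced words.  The cancelled part
    is returned as data, so that no choice is needed to speak of it later. *)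
Lemma cancel_decomp u v : reduced u -> reduced v ->
  {p | exists a b, [/\ u = a ++ word_inv p, v = p ++ b & reduced (a ++ b)]}.
Proof.
elim/last_ind: u v => [|u x IH] v ru rv; first by exists [::], [::], v.
case: v rv => [|y v] rv; first by exists [::], (rcons u x), [::]; rewrite !cats0.
have [eyx|neyx] := eqVneq y (letter_inv x).
  have [||p ep] := IH v.
  - by move: ru; rewrite -cats1 => /reduced_catl.
  - exact: (@reduced_catr [:: y]).
  exists (y :: p); have [a [b [-> -> rab]]] := ep; exists a, b; split=> //.
  by rewrite eyx word_inv_cons letter_invK rcons_cat.
exists [::], (rcons u x), (y :: v); rewrite cats0; split=> //.
by rewrite reduced_cat_rcons ru neyx.
Qed.

End WordInv.

Section Lift.
Variables (T : choiceType) (H : groupType).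
Implicit Types (f : T -> H) (x y : free_group T).

Definition hom_lift f x : H := word_eval f (fg_word x).

Lemma word_eval_push f l w : word_eval f (push l w) = letter_eval f l * word_eval f w.
Proof.
case: w => [|m w] /=; first by rewrite word_eval_cons.
case: eqP => [->|_]; last by rewrite word_eval_cons.
by rewrite word_eval_cons letter_eval_inv mulgA mulgV mul1g.
Qed.

Lemma hom_liftM f x y : hom_lift f (x * y) = hom_lift f x * hom_lift f y.
Proof.
rewrite /hom_lift /=; elim: (fg_word x) => [|l w IH] /=.
  by rewrite /word_eval big_nil mul1g.
by rewrite word_eval_push IH word_eval_cons mulgA.
Qed.

Lemma hom_lift1 f : hom_lift f 1 = 1.
Proof. by rewrite /hom_lift /word_eval big_nil. Qed.

Lemma hom_liftV f x : hom_lift f x^-1 = (hom_lift f x)^-1.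
Proof. exact: word_eval_inv. Qed.

Lemma hom_lift_gen f t : hom_lift f (fg_gen t) = f t.
Proof. by rewrite /hom_lift word_eval1. Qed.

Lemma hom_lift_letter f (I : Type) (X : I -> free_group T) l :
  hom_lift f (letter_eval X l) = letter_eval (hom_lift f \o X) l.
Proof. by case: l => x []; rewrite /letter_eval /= ?hom_liftV. Qed.

Lemma hom_lift_word f (I : Type) (X : I -> free_group T) w :
  hom_lift f (word_eval X w) = word_eval (hom_lift f \o X) w.
Proof.
rewrite /word_eval; elim: w => [|l w IH]; first by rewrite !big_nil hom_lift1.
by rewrite !big_cons hom_liftM IH hom_lift_letter.
Qed.

End Lift.

(** * Generating sets of minimal size are free bases *)

Definition generates (I : Type) (G : groupType) (X : I -> G) : Prop :=
  forall x, exists w, word_eval X w = x.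

(** Restriction to [X] injects the homomorphisms to [H] into the functions from
    [I] to [H] because [X] generates, and the two finite sets have the same
    cardinality. *)
Lemma hom_extension (T I : finType) (X : I -> free_group T)
    (H : finGroupType) (h : I -> H) :
  #|I| = #|T| -> generates X -> exists f : T -> H, forall i, hom_lift f (X i) = h i.
Proof.
move=> cardIT genX.
pose restr (f : {ffun T -> H}) : {ffun I -> H} := [ffun i => hom_lift f (X i)].
have inj : injective restr.
  move=> f f' /ffunP eq_ff'; apply/ffunP => t.
  rewrite -(hom_lift_gen f) -(hom_lift_gen f'); have [w <-] := genX (fg_gen t).
  rewrite !hom_lift_word /word_eval; apply: eq_bigr => -[i b] _.
  by rewrite /letter_eval /=; move: (eq_ff' i); rewrite !ffunE => ->.
have [k _ kK] : bijective restr.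
  by apply: inj_card_bij => //; rewrite !card_ffun cardIT.
exists (k (finfun h)) => i.
by have /ffunP/(_ i) := kK (finfun h); rewrite !ffunE.
Qed.

Lemma perm_prescribed (T : finType) (s t : seq T) :
  uniq s -> uniq t -> size s = size t -> exists p : {perm T}, map p s = t.
Proof.
elim: s t => [|x s IH] [|y t] //=; first by exists 1.
move=> /andP[xs us] /andP[yt ut] [/(IH _ us ut)[p ep]].
exists (p * tperm (p x) y); rewrite permM tpermL; congr cons.
rewrite -[RHS]ep; apply/eq_in_map => z zs; rewrite permM tpermD //.
  by rewrite (inj_eq perm_inj); apply: contraNneq xs => ->.
by apply: contraNneq yt => ->; rewrite -ep map_f.
Qed.

(** Residual finiteness of free groups.  Each letter of [w] should move the point
    reached so far one step along the path 0, 1, ..., [size w].  For a given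
    generator these requirements form a partial injection because [w] is
    reduced, and a partial injection of a finite set extends to a
    permutation. *)
Lemma free_residually_finite (I : eqType) (w : seq (I * bool)) :
  reduced w -> w != [::] ->
  exists h : I -> {perm 'I_(size w).+1}, word_eval h w != 1.
Proof.
move=> rw wn0; set n := size w; case: w rw wn0 @n => // l0 w0; set w := l0 :: w0 => rw _ n.
pose step i (k : nat) := (nth l0 w k).1 == i.
(* Letter number k leads from point k to point k.+1; if it is an inverse, then
   its generator leads from k.+1 to k. *)
pose endpoint (e : bool) (k : nat) : 'I_n.+1 := inord (k + (e (+) (nth l0 w k).2)).
have red k : k.+1 < n -> nth l0 w k.+1 != letter_inv (nth l0 w k).
  by move=> kn; move/(sortedP l0): rw => /(_ k kn).
have endpoint_uniq e i : uniq (map (endpoint e) (filter (step i) (iota 0 n))).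
  rewrite map_inj_in_uniq ?filter_uniq ?iota_uniq // => a b.
  rewrite !mem_filter !mem_iota /step add0n /= => /andP[/eqP ai an] /andP[/eqP bi bn].
  move/(congr1 val); rewrite /= !inordK ?ltnS; [|lia|lia].
  move=> eab; have [//|nab] := eqVneq a b.
  wlog ltab : a b an bn ai bi eab nab / a < b.
    move=> W; have [] := ltngtP a b; [exact: W| |by move/eqP: nab].
    by move=> ba; apply/esym/W; rewrite // eq_sym.
  (* Only adjacent positions can share an endpoint, and then their letters
     would be mutually inverse. *)
  have eb : b = a.+1 by lia.
  have := red a; rewrite -eb => /(_ bn).
  rewrite /letter_inv ai -bi; case: (nth l0 w b) (nth l0 w a) eab => [? bb] [? ba] /=.
  by case: e; case: ba; case: bb; rewrite ?eqxx //= => ?; lia.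
have exh i : exists p : {perm 'I_n.+1}, [forall k : 'I_n,
    step i k ==> (p (endpoint false k) == endpoint true k)].
  have [|p ep] := perm_prescribed (endpoint_uniq false i) (endpoint_uniq true i).
    by rewrite !size_map.
  exists p; apply/forallP => k; apply/implyP => sk.
  move: ep; rewrite -map_comp => /eq_in_map/(_ (val k)) ePk; apply/eqP/ePk.
  by rewrite mem_filter sk mem_iota ltn_ord.
pose h i := xchoose (exh i); exists h; apply/eqP => /(congr1 (fun p : {perm _} => p ord0)).
have hP k : k < n -> h (nth l0 w k).1 (endpoint false k) = endpoint true k.
  move=> kn; have /forallP/(_ (Ordinal kn)) := xchooseP (exh (nth l0 w k).1).
  by move/implyP/(_ (eqxx _))/eqP.
have walk k : k <= n -> word_eval h (take k w) ord0 = inord k.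
  elim: k => [|k IH] kn.
    by rewrite take0 /word_eval big_nil perm1; apply: val_inj; rewrite /= inordK.
  rewrite (take_nth l0) // -cats1 word_eval_cat permM IH 1?ltnW // word_eval1.
  have := hP k kn; rewrite /endpoint /letter_eval; case: (nth l0 w k) => i [] /=.
    by rewrite addn1 addn0 => <-; rewrite permK.
  by rewrite addn1 addn0.
have := walk n (leqnn n); rewrite take_size => -> /(congr1 val).
by rewrite perm1 /= inordK.
Qed.

Lemma generators_free (T I : finType) (X : I -> free_group T) w :
  #|I| = #|T| -> generates X -> reduced w -> word_eval X w = 1 -> w = [::].
Proof.
move=> cardIT genX rw ew; apply/eqP/negPn/negP => wn0.
have [h /eqP[]] := free_residually_finite rw wn0.
have [f ef] := hom_extension h cardIT genX.
rewrite -(hom_lift1 f) -ew hom_lift_word /word_eval.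
by apply: eq_bigr => -[i b] _; rewrite /letter_eval /= ef.
Qed.

(** * The one-vertex property *)

(** The Heisenberg group over F_2: upper unitriangular matrices of size 3, the
    last coordinate being the central one. *)
Definition heis : Type := bool * bool * bool.
HB.instance Definition _ := Finite.on heis.

Definition Heis (a b c : bool) : heis := (a, b, c).

Definition heis_mul (x y : heis) : heis :=
  Heis (x.1.1 (+) y.1.1) (x.1.2 (+) y.1.2) (x.2 (+) y.2 (+) x.1.1 && y.1.2).
Definition heis_one : heis := Heis false false false.
Definition heis_inv (x : heis) : heis := Heis x.1.1 x.1.2 (x.2 (+) x.1.1 && x.1.2).

Lemma heis_mulA : associative heis_mul.
Proof. by move=> [[[] []] []] [[[] []] []] [[[] []] []]. Qed.
Lemma heis_mul1 : left_id heis_one heis_mul.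
Proof. by move=> [[[] []] []]. Qed.
Lemma heis_mulV : left_inverse heis_one heis_inv heis_mul.
Proof. by move=> [[[] []] []]. Qed.

HB.instance Definition _ :=
  Finite_isGroup.Build heis heis_mulA heis_mul1 heis_mulV.

Lemma heisM (x y : heis) :
  x * y = Heis (x.1.1 (+) y.1.1) (x.1.2 (+) y.1.2) (x.2 (+) y.2 (+) x.1.1 && y.1.2).
Proof. by []. Qed.

Lemma heisV (x : heis) : x^-1 = Heis x.1.1 x.1.2 (x.2 (+) x.1.1 && x.1.2).
Proof. by []. Qed.

Lemma heis_commutator (x y : heis) :
  x * y * x^-1 * y^-1 = Heis false false (x.1.1 && y.1.2 (+) y.1.1 && x.1.2).
Proof. by case: x => [[[] []] []]; case: y => [[[] []] []]. Qed.

Lemma hom_lift_prod (T : choiceType) (H : groupType) (f : T -> H) (I : Type)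
    (r : seq I) (F : I -> free_group T) :
  hom_lift f (\prod_(i <- r) F i) = \prod_(i <- r) hom_lift f (F i).
Proof.
elim: r => [|i r IH]; first by rewrite !big_nil hom_lift1.
by rewrite !big_cons hom_liftM IH.
Qed.

Lemma hom_lift_boundary g (H : groupType) (f : 'I_g + 'I_g -> H) :
  hom_lift f (boundary g) = \prod_(i < g)
     (f (inl i) * f (inr i) * (f (inl i))^-1 * (f (inr i))^-1).
Proof.
by rewrite hom_lift_prod; apply: eq_bigr => i _; rewrite !hom_liftM !hom_liftV !hom_lift_gen.
Qed.

Lemma heis_prod_central (I : Type) (r : seq I) (F : I -> bool) :
  \prod_(i <- r) Heis false false (F i) = Heis false false (\big[addb/false]_(i <- r) F i).
Proof.
elim: r => [|i r IH]; first by rewrite !big_nil.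
by rewrite !big_cons IH heisM /= addbF.
Qed.

Lemma hom_lift_eq_component (T I : choiceType) (X : I -> free_group T)
    (f f' : T -> heis) (pr : heis -> bool) :
  {morph pr : x y / x * y >-> x (+) y} -> generates X ->
  (forall i, pr (hom_lift f (X i)) = pr (hom_lift f' (X i))) ->
  forall t, pr (f t) = pr (f' t).
Proof.
move=> prM genX eqX t.
have pr1 : pr 1 = false by have := prM 1 1; rewrite mul1g; case: (pr 1).
have prV x : pr x^-1 = pr x.
  by have := prM x x^-1; rewrite mulgV pr1; case: (pr x); case: (pr _).
rewrite -(hom_lift_gen f) -(hom_lift_gen f'); have [w <-] := genX (fg_gen t).
rewrite !hom_lift_word; elim: w => [|[i []] w IH].
- by rewrite /word_eval !big_nil.
- by rewrite !word_eval_cons !prM IH /letter_eval /= !prV eqX.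
- by rewrite !word_eval_cons !prM IH /letter_eval /= eqX.
Qed.

Lemma card_surface_gens g : #|'I_(2 * g)| = #|{: 'I_g + 'I_g}|.
Proof. by rewrite card_sum !card_ord mul2n addnn. Qed.

Definition chord_word g (X : 'I_(2 * g) -> surface_group g)
    (v : seq ('I_(2 * g) * bool)) :=
  perm_eq v (enum {: 'I_(2 * g) * bool}) /\ word_eval X v = (boundary g)^-1.

Lemma size_chord_word g (X : 'I_(2 * g) -> surface_group g) v :
  chord_word X v -> size v = (4 * g)%N.
Proof.
case=> pv _; rewrite (perm_size pv) -cardE card_prod card_ord card_bool; lia.
Qed.

(** For each generator [e] of the standard basis let [rho e] be the homomorphism
    to the Heisenberg group that sends [e] to the generator of the second
    coordinate and the other standard generators to 1.  View [v] as the sides of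
    a polygon glued in inverse pairs, and [f] as a function on its corners that
    respects the gluing.  Let [t k] be [f k] in the first coordinate.
    Multiplying the value of [rho e] on the side between the corners [k] and
    [k.+1] by [t k] on the left and by the inverse of [t k.+1] on the right
    gives inverse values on paired sides, so it defines another homomorphism.
    The [t k] cancel in the product over all sides, so both homomorphisms agree
    on the boundary, where [rho e] is 1 because its image is abelian.  The
    central coordinate of this equation is the coboundary of [f] on the standard
    generator dual to [e]. *)
Lemma one_vertex g (X : 'I_(2 * g) -> surface_group g) v l0 (f : nat -> bool) :
  generates X -> chord_word X v ->
  f 0 = false -> f (4 * g)%N = false ->
  (forall i k, i < (4 * g)%N -> k < (4 * g)%N ->
     nth l0 v k = letter_inv (nth l0 v i) -> f k = f i.+1) ->
  forall i, i <= (4 * g)%N -> f i = false.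
Proof.
move=> genX cv f0 fN fP.
have sv := size_chord_word cv; case: cv => pv ev.
have vall l : l \in v by rewrite (perm_mem pv) mem_enum.
have uv : uniq v by rewrite (perm_uniq pv) enum_uniq.
pose t k : heis := Heis (f k) false false.
pose rho (e : 'I_g + 'I_g) (s : 'I_g + 'I_g) : heis := Heis false (s == e) false.
pose pos x := index (x, false) v.
pose tw e x : heis := t (pos x) * hom_lift (rho e) (X x) * (t (pos x).+1)^-1.
have ext e := hom_extension (tw e) (card_surface_gens g) genX.
have twP e (fe : 'I_g + 'I_g -> heis) :
    (forall x, hom_lift fe (X x) = tw e x) -> forall k, k < (4 * g)%N ->
  hom_lift fe (letter_eval X (nth l0 v k)) =
    t k * hom_lift (rho e) (letter_eval X (nth l0 v k)) * (t k.+1)^-1.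
  move=> hfe k kN; case ek: (nth l0 v k) => [x b].
  have pN : pos x < (4 * g)%N by rewrite -sv index_mem.
  have np : nth l0 v (pos x) = (x, false) by rewrite nth_index.
  case: b ek => ek; rewrite /letter_eval /= ?hom_liftV hfe /tw.
    rewrite !invgM invgK mulgA /t.
    rewrite -(fP (pos x) k) ?(fP k (pos x)) //; first by rewrite np ek.
    by rewrite np ek.
  suff -> : pos x = k by [].
  by rewrite /pos -ek index_uniq // sv.
have fst0 (fe : 'I_g + 'I_g -> heis) :
    (forall s, (fe s).1.1 = false) -> forall y, (hom_lift fe y).1.1 = false.
  move=> fe0 y; rewrite /hom_lift; elim: (fg_word y) => [|[s []] u IH].
  - by rewrite /word_eval big_nil.
  - by rewrite word_eval_cons heisM /= IH fe0.
  - by rewrite word_eval_cons heisM /= IH fe0.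
have rho_fst e y : (hom_lift (rho e) y).1.1 = false by apply: fst0.
have bd e (fe : 'I_g + 'I_g -> heis) :
    (forall x, hom_lift fe (X x) = tw e x) -> hom_lift fe (boundary g) = 1.
  move=> hfe; apply: invg_inj; rewrite -hom_liftV -ev invg1.
  have walk k : k <= (4 * g)%N -> hom_lift fe (word_eval X (take k v)) =
      t 0 * hom_lift (rho e) (word_eval X (take k v)) * (t k)^-1.
    elim: k => [|k IH] kN.
      by rewrite take0 /word_eval big_nil !hom_lift1 mulg1 mulgV.
    rewrite (take_nth l0) ?sv // -cats1 word_eval_cat word_eval1 !hom_liftM.
    rewrite IH 1?ltnW // (twP e fe hfe) // !mulgA; congr (_ * _ * _).
    by rewrite mulgKV.
  have := walk _ (leqnn _); rewrite -{1 2}sv take_size => ->.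
  rewrite /t f0 fN ev hom_liftV hom_lift_boundary.
  rewrite (eq_bigr (fun=> 1)) ?big1 ?invg1 ?mulg1 ?mulgV // => i _.
  by rewrite heis_commutator.
have delta0 e (fe : 'I_g + 'I_g -> heis) s :
    (forall x, hom_lift fe (X x) = tw e x) -> (fe s).1.1 = false.
  move=> hfe.
  (* The generator dual to s in the intersection form isolates fe s below. *)
  pose e' := match s with inl i => inr i | inr i => inl i end.
  have [fe' hfe'] := ext e'.
  have -> : (fe s).1.1 = (fe' s).1.1.
    apply: (hom_lift_eq_component (pr := fun h : heis => h.1.1) _ genX) => // x.
    by rewrite hfe hfe' /tw !heisM !heisV /= !rho_fst.
  have eps r : (fe' r).1.2 = (r == e').
    rewrite -[RHS]/((rho e' r).1.2).
    apply: (hom_lift_eq_component (pr := fun h : heis => h.1.2) _ genX) => // x.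
    by rewrite hfe' /tw !heisM !heisV /= addbF.
  have := bd _ _ hfe'; rewrite hom_lift_boundary.
  under eq_bigr do rewrite heis_commutator !eps.
  rewrite heis_prod_central => /(congr1 snd) /=.
  rewrite /e'; case: s {fe hfe e' hfe' eps} => i.
- rewrite (eq_bigr (fun j => if j == i then (fe' (inl i)).1.1 else false)).
    by rewrite -big_mkcond big_pred1_eq.
  move=> j _; rewrite (inj_eq inr_inj) andbF addbF.
  by case: eqP => [->|_]; rewrite ?andbT ?andbF.
- rewrite (eq_bigr (fun j => if j == i then (fe' (inr i)).1.1 else false)).
    by rewrite -big_mkcond big_pred1_eq.
  move=> j _; rewrite (inj_eq inl_inj) andbF addFb.
  by case: eqP => [->|_]; rewrite ?andbT ?andbF.
elim=> [//|i IH] iN.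
have g_gt0 : 0 < g by lia.
have [fe hfe] : exists fe, forall x, hom_lift fe (X x) = tw (inl (Ordinal g_gt0)) x.
  exact: ext.
have := fst0 fe (fun s => delta0 _ _ s hfe) (letter_eval X (nth l0 v i)).
by rewrite (twP _ _ hfe) // !heisM /= rho_fst IH ?(ltnW iN) // addbF.
Qed.

(** * Chord words *)

Lemma nth_uniq_inj (T : eqType) (x0 : T) (s : seq T) i j :
  uniq s -> i < size s -> j < size s -> nth x0 s i = nth x0 s j -> i = j.
Proof. by move=> us si sj e; apply/eqP; rewrite -(nth_uniq x0 si sj us) e. Qed.

Lemma reduced_word_inj (T I : finType) (X : I -> free_group T) s t :
  #|I| = #|T| -> generates X -> reduced s -> reduced t ->
  word_eval X s = word_eval X t -> s = t.
Proof.
move=> cardIT genX rs rt est.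
have [p [a [b [ea eb rab]]]] := cancel_decomp rs (reduced_word_inv rt).
have : a ++ b = [::].
  apply: (generators_free cardIT genX rab); rewrite word_eval_cat.
  transitivity (word_eval X s * word_eval X (word_inv t)).
    rewrite ea eb !word_eval_cat word_eval_inv !mulgA; congr (_ * _).
    by rewrite mulgKV.
  by rewrite word_eval_inv est mulgV.
case: a ea {rab} => //= ea; case: b eb => //= eb _.
by rewrite -[t]word_invK eb cats0 ea.
Qed.

Lemma reduced_letter_pair (T : choiceType) (l m : T * bool) :
  reduced [:: l; m] = (m != letter_inv l).
Proof. by rewrite /reduced /= andbT. Qed.

Section ChordWords.
Variables (g : nat) (X : 'I_(2 * g) -> surface_group g).
Hypothesis genX : generates X.
Implicit Types (l m : 'I_(2 * g) * bool) (v : seq ('I_(2 * g) * bool)).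

Lemma letter_eval_inj : injective (letter_eval X).
Proof.
move=> l m elm; suff: [:: l] = [:: m] by case.
by apply: (reduced_word_inj (card_surface_gens g) genX); rewrite // !word_eval1.
Qed.

Lemma chord_word_uniq v : chord_word X v -> uniq v.
Proof. by case=> pv _; rewrite (perm_uniq pv) enum_uniq. Qed.

Lemma chord_word_mem v l : chord_word X v -> l \in v.
Proof. by case=> pv _; rewrite (perm_mem pv) mem_enum. Qed.

(** Two adjacent inverse letters would cut off a second vertex, at the corner
    between them. *)
Lemma chord_word_reduced v : chord_word X v -> reduced v.
Proof.
move=> cv; have uv := chord_word_uniq cv; have sv := size_chord_word cv.
case: v cv uv sv => // l0 v0; set v := l0 :: v0 => cv uv sv.
apply/(sortedP l0) => i; rewrite sv => iN; apply/eqP => ei.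
pose f k := k == i.+1.
suff: f i.+1 = false by rewrite /f eqxx.
apply: (one_vertex (l0 := l0) genX cv); rewrite ?(ltnW iN) //.
  by rewrite /f; apply/negP => /eqP; lia.
move=> a k aN kN eka; rewrite /f eqSS; apply/eqP/eqP => [ek|ea].
  apply: (nth_uniq_inj (x0 := l0) uv); rewrite ?sv ?(ltnW iN) //.
  by apply: (can_inj (@letter_invK _)); rewrite -eka -ei ek.
by apply: (nth_uniq_inj (x0 := l0) uv); rewrite ?sv // eka ei ea.
Qed.

Lemma chord_word_inj v v' : chord_word X v -> chord_word X v' -> v = v'.
Proof.
move=> cv cv'; apply: (reduced_word_inj (card_surface_gens g) genX).
- exact: chord_word_reduced.
- exact: chord_word_reduced.
by case: cv cv' => _ -> [_ ->].
Qed.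

End ChordWords.

Lemma perm_map_preim (T U : eqType) (f : T -> U) (s : seq T) (c : seq U) :
  perm_eq c (map f s) -> exists2 u, perm_eq u s & c = map f u.
Proof.
case: s => [|x0 s] pc.
  by exists [::]; rewrite // (perm_nilP pc).
have /(perm_iotaP (f x0))[js pj ->] := pc; exists (map (nth x0 (x0 :: s)) js).
  by rewrite -[X in perm_eq _ X](mkseq_nth x0) perm_map //; move: pj; rewrite size_map.
rewrite -map_comp; apply/eq_in_map => j; rewrite (perm_mem pj) mem_iota size_map.
by move=> jN; rewrite /comp (nth_map x0).
Qed.

Section ChordEnds.
Variables (g : nat).
Implicit Type X : CG_set g.

Lemma chord_ends_word X : exists2 v, chord_word X v &
  chord_ends X = map (letter_eval X) v :> seq _.
Proof.
have /andP[pc /eqP ec] := xchooseP (chord_ends_exist X).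
have [v pv ev] := perm_map_preim pc; exists v => //.
by split=> //; rewrite /word_eval -ec ev big_map.
Qed.

Lemma chord_ends_eq X v : chord_word X v ->
  chord_ends X = map (letter_eval X) v :> seq _.
Proof.
move=> cv; have [v' cv' ->] := chord_ends_word X.
by rewrite (chord_word_inj (@cg_generates _ X) cv cv').
Qed.

Lemma chord_ends_perm X : perm_eq (chord_ends X) (letters X).
Proof. by have /andP[] := xchooseP (chord_ends_exist X). Qed.

End ChordEnds.

(** * Chord slides *)

Section WordSpan.
Variables (I : Type) (G : groupType) (Y : I -> G).

Lemma word_span_word (J : Type) (X : J -> G) (w : seq (J * bool)) :
  (forall x, exists u, word_eval Y u = X x) ->
  exists u, word_eval Y u = word_eval X w.
Proof.
move=> YX; elim: w => [|[x b] w [u eu]].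
  by exists [::]; rewrite /word_eval !big_nil.
have [t et] := YX x.
exists ((if b then rev (map (@letter_inv I) t) else t) ++ u).
rewrite {1}/word_eval big_cat -!/(word_eval _ _) eu [RHS]/word_eval big_cons.
by congr (_ * _); rewrite /letter_eval; case: b; rewrite /= ?word_eval_inv et.
Qed.

Lemma generates_trans (J : Type) (X : J -> G) :
  generates X -> (forall x, exists u, word_eval Y u = X x) -> generates Y.
Proof.
move=> genX YX y; have [w <-] := genX y; exact: word_span_word.
Qed.

End WordSpan.

(** Both slides at once: [m] is slid over its neighbour [l], to the left across
    [l] if [b] holds and to the right otherwise.  The new generating set keeps the
    index set; only the value of [l] changes, to the product of the two
    neighbours, and the boundary word is updated by the substitution
    [slid_sub]. *)
Section Slide.
Variables (g : nat) (X : CG_set g) (v : seq ('I_(2 * g) * bool)).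
Hypothesis cv : chord_word X v.
Variables (l m : 'I_(2 * g) * bool) (b : bool) (v1 v2 : seq ('I_(2 * g) * bool)).
Hypothesis ev : v = v1 ++ (if b then [:: l; m] else [:: m; l]) ++ v2.

Let cl := letter_eval X l.
Let cm := letter_eval X m.
Definition slid_letter : surface_group g := if b then cl * cm else cm * cl.
Let d := slid_letter.

Definition slid_gen (x : 'I_(2 * g)) : surface_group g :=
  if x == l.1 then (if l.2 then d^-1 else d) else X x.
Let Y := slid_gen.

Definition slid_sub (k : 'I_(2 * g) * bool) :=
  if k == m then [::]
  else if k == letter_inv l then
    (if b then [:: m; letter_inv l] else [:: letter_inv l; m])
  else [:: k].
Let theta := slid_sub.

Definition slid_word := flatten (map theta v).

Lemma slide_distinct : m != l /\ m != letter_inv l.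
Proof.
have rv := chord_word_reduced (@cg_generates _ X) cv.
have uv := chord_word_uniq cv.
move: rv uv; rewrite ev => /reduced_catr /reduced_catl rlm.
rewrite cat_uniq => /and3P[_ _]; rewrite cat_uniq => /and3P[].
case: (b) rlm; rewrite reduced_letter_pair /= !inE andbT => -nlm ulm _ _; split=> //.
  by rewrite eq_sym.
by rewrite eq_letter_inv eq_sym.
Qed.

Lemma letter_eval_slid k : letter_eval Y k =
  if k == l then d else if k == letter_inv l then d^-1 else letter_eval X k.
Proof.
case: k => x c; rewrite /letter_eval /Y /slid_gen /letter_inv.
rewrite -!pair_eqE /pair_eq /=; case: (x == l.1) => //=.
by case: c; case: (l.2); rewrite ?invgK.
Qed.

Let lNl : (l == letter_inv l) = false.
Proof. by rewrite eq_sym; apply/negbTE/letter_inv_neq. Qed.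

Lemma letter_eval_slid_m : letter_eval Y m = cm.
Proof.
by have [/negPf n1 /negPf n2] := slide_distinct; rewrite letter_eval_slid n1 n2.
Qed.

(** The substitution spells the old value of each letter in the new generators;
    the pair of neighbours is the exception, as [l] alone already spells its
    product. *)
Lemma word_eval_slid_sub k : k != l -> k != m -> word_eval Y (theta k) = letter_eval X k.
Proof.
move=> kl km; rewrite /theta /slid_sub (negPf km).
have [->|kNl] := eqVneq k (letter_inv l); last first.
  by rewrite word_eval1 letter_eval_slid (negPf kl) (negPf kNl).
have eNl : letter_eval Y (letter_inv l) = d^-1.
  by rewrite letter_eval_slid eqxx eq_sym lNl.
rewrite letter_eval_inv -/cl.
case eb: b; rewrite word_eval_cons word_eval1 letter_eval_slid_m eNl /d /slid_letter eb invgM.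
  by rewrite mulgA mulgV mul1g.
by rewrite -mulgA mulVg mulg1.
Qed.

Lemma word_eval_slid : word_eval Y slid_word = (boundary g)^-1.
Proof.
have uv := chord_word_uniq cv.
have [ml mNl] := slide_distinct.
have eva w : l \notin w -> m \notin w -> word_eval Y (flatten (map theta w)) = word_eval X w.
  elim: w => [|k w IH]; first by rewrite /word_eval !big_nil.
  rewrite !inE !negb_or => /andP[lk lw] /andP[mk mw] /=.
  by rewrite word_eval_cat word_eval_cons IH // word_eval_slid_sub // eq_sym.
have thl : theta l = [:: l] by rewrite /theta /slid_sub eq_sym (negPf ml) lNl.
have thm : theta m = [::] by rewrite /theta /slid_sub eqxx.
case: cv => _ <-; rewrite /slid_word ev !map_cat !flatten_cat !word_eval_cat.
move: uv; rewrite ev uniq_catC -catA cat_uniq => /and3P[_ dis _].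
have [l1 l2 m1 m2] : [/\ l \notin v1, l \notin v2, m \notin v1 & m \notin v2].
  have nin k : k \in (if b then [:: l; m] else [:: m; l]) -> k \notin v2 ++ v1.
    by move=> kin; apply: contra dis => kv; apply/hasP; exists k.
  have /nin : l \in (if b then [:: l; m] else [:: m; l]) by case: b; rewrite !inE eqxx ?orbT.
  have /nin : m \in (if b then [:: l; m] else [:: m; l]) by case: b; rewrite !inE eqxx ?orbT.
  by rewrite !mem_cat !negb_or => /andP[-> ->] /andP[-> ->].
rewrite (eva v1) // (eva v2) //; congr (_ * (_ * _)).
case eb: b; rewrite /= thl thm /= word_eval1 letter_eval_slid eqxx /d /slid_letter eb;
  by rewrite word_eval_cons word_eval1.
Qed.

Lemma perm_slid_word : perm_eq slid_word v.
Proof.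
have uv := chord_word_uniq cv.
have [ml mNl] := slide_distinct.
pose w := rem (letter_inv l) (rem m v).
have pw : perm_eq v (m :: letter_inv l :: w).
  apply: perm_trans (perm_to_rem (chord_word_mem m cv)) _.
  rewrite perm_cons; apply: perm_to_rem.
  by rewrite mem_rem_uniq // inE /= eq_sym mNl (chord_word_mem _ cv).
have mw : m \notin w by move: uv; rewrite (perm_uniq pw) /= inE negb_or => /andP[/andP[]].
have lw : letter_inv l \notin w by move: uv; rewrite (perm_uniq pw) /= => /and3P[].
rewrite (permPr pw).
apply: perm_trans (perm_flatten (perm_map theta pw)) _ => /=.
have -> : flatten (map theta w) = w.
  elim: w mw lw {pw} => //= k w IH; rewrite !inE !negb_or => /andP[mk mw] /andP[lk lw].
  by rewrite IH // /theta /slid_sub eq_sym (negPf mk) eq_sym (negPf lk).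
rewrite /theta /slid_sub eqxx eq_sym (negPf mNl) eqxx.
by case: (b) => //=; rewrite -(cat1s m) -cat1s -[X in perm_eq _ X]/([:: m] ++ _) perm_catCA.
Qed.

Lemma slid_generates : generates Y.
Proof.
apply: (generates_trans (@cg_generates _ X)) => x.
have [exl|nxl] := eqVneq x l.1; last first.
  by exists [:: (x, false)]; rewrite word_eval1 /letter_eval /Y /slid_gen (negPf nxl).
pose u := if b then [:: l; letter_inv m] else [:: letter_inv m; l].
have eu : word_eval Y u = cl.
  rewrite /u; case eb: b; rewrite word_eval_cons word_eval1 letter_eval_inv letter_eval_slid_m;
    rewrite letter_eval_slid eqxx /d /slid_letter eb.
    by rewrite -mulgA mulgV mulg1.
  by rewrite mulgA mulVg mul1g.
exists (if l.2 then word_inv u else u).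
case el: (l.2); rewrite ?word_eval_inv eu /cl /letter_eval el exl //.
by rewrite invgK.
Qed.

Lemma slid_chord_word : chord_word Y slid_word.
Proof.
split; last exact: word_eval_slid.
by apply: perm_trans perm_slid_word _; case: cv.
Qed.

(** The new boundary word is automatically reduced, by the one-vertex property
    applied to the new generators. *)
Lemma slid_boundary : exists w : seq ('I_(2 * g) * bool),
  [/\ reduced w, forall k, count_mem k w = 1%N & word_eval Y w = boundary g].
Proof.
exists (word_inv slid_word); split.
- exact/reduced_word_inv/(chord_word_reduced slid_generates)/slid_chord_word.
- move=> k; rewrite count_uniq_mem; last first.
    rewrite rev_uniq map_inj_uniq; last exact: can_inj (@letter_invK _).
    exact: chord_word_uniq slid_chord_word.
  rewrite mem_rev -[k]letter_invK map_f //; exact: chord_word_mem slid_chord_word.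
by rewrite word_eval_inv word_eval_slid invgK.
Qed.

Definition slid_CG_set := CGSet slid_generates slid_boundary.

Lemma slid_chord_ends :
  chord_ends slid_CG_set = map (letter_eval Y) slid_word :> seq _.
Proof. exact: (@chord_ends_eq _ slid_CG_set _ slid_chord_word). Qed.

Lemma sum_chord_ends_slid (E : surface_group g -> nat) :
  (\sum_(c <- chord_ends slid_CG_set) E c + (E cl + E cl^-1) =
   \sum_(c <- chord_ends X) E c + (E d + E d^-1))%N.
Proof.
have sumE (Z : CG_set g) : (\sum_(c <- chord_ends Z) E c =
    E (letter_eval Z l) + (E (letter_eval Z (letter_inv l)) +
    \sum_(k | (k != l) && (k != letter_inv l)) E (letter_eval Z k)))%N.
  rewrite (perm_big _ (chord_ends_perm Z)) /= big_map big_enum /=.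
  by rewrite (bigD1 l) //= (bigD1 (letter_inv l)) ?letter_inv_neq.
rewrite !sumE.
have -> : letter_eval slid_CG_set l = d by rewrite (letter_eval_slid l) eqxx.
have -> : letter_eval slid_CG_set (letter_inv l) = d^-1.
  by rewrite (letter_eval_slid (letter_inv l)) eqxx eq_sym lNl.
rewrite (eq_bigr (fun k => E (letter_eval X k))); last first.
  move=> k /andP[kl kNl].
  by rewrite [letter_eval _ k](letter_eval_slid k) (negPf kl) (negPf kNl).
rewrite letter_eval_inv -/cl.
by move: (E d) (E d^-1) (E cl) (E cl^-1) (\sum_(k | _) _)%N => *; lia.
Qed.

Lemma slid_chord_ends_flatten (l0 : 'I_(2 * g) * bool) :
  chord_ends slid_CG_set = flatten [seq
    let k := nth l0 v i in
    if k == m then [::] else if k == l then [:: d]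
    else if k == letter_inv l then (if b then [:: cm; d^-1] else [:: d^-1; cm])
    else [:: letter_eval X k] | i <- iota 0 (size v)] :> seq _.
Proof.
rewrite slid_chord_ends /slid_word map_flatten -map_comp.
rewrite -{1}(mkseq_nth l0 v) -map_comp; congr flatten; apply: eq_map => i /=.
move: (nth l0 v i) => k; rewrite /theta /slid_sub.
case: (k == m) => //; have [->|kl] := eqVneq k l.
  by rewrite lNl /= letter_eval_slid eqxx.
have [_|kNl] := eqVneq k (letter_inv l).
  by case: (b); rewrite /= letter_eval_slid_m letter_eval_slid eqxx eq_sym lNl.
by rewrite /= letter_eval_slid (negPf kl) (negPf kNl).
Qed.

End Slide.

(** The equation holds for every function [E], as the slide only changes the
    letters [x] and [x^-1]; it will be used for the energy. *)
Lemma slide_exists g (X : CG_set g) (left : bool) j : j.+1 < (4 * g)%N ->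
  let a := nth 1 (chord_ends X) j in
  let b := nth 1 (chord_ends X) j.+1 in
  let x := if left then a else b in
  exists Y : CG_set g, chord_slide (diagram X) (diagram Y) /\
    forall E : surface_group g -> nat,
     (\sum_(c <- chord_ends Y) E c + (E x + E x^-1) =
      \sum_(c <- chord_ends X) E c + (E (a * b)%g + E (a * b)%g^-1))%N.
Proof.
move=> jN a b x; have [v cv ev] := chord_ends_word X.
have sv := size_chord_word cv; have uv := chord_word_uniq cv.
have sc : size (chord_ends X) = size v by rewrite size_tuple sv.
have sj1 : j.+1 < size v by rewrite sv.
have sj : j < size v by exact: ltnW.
have [l0 _] : {l0 : 'I_(2 * g) * bool | true} by case: (v) sj => [//|l0 ? _]; exists l0.
pose l := nth l0 v j; pose m := nth l0 v j.+1.
have ea : a = letter_eval X l by rewrite /a ev (nth_map l0).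
have eb : b = letter_eval X m by rewrite /b ev (nth_map l0).
have dv : v = take j v ++ [:: l; m] ++ drop j.+2 v.
  by rewrite -{1}(cat_take_drop j v) (drop_nth l0) // (drop_nth l0 (n := j.+1)).
have injX := letter_eval_inj (@cg_generates _ X).
have nthc i : i < size v -> nth 1 (chord_ends X) i = letter_eval X (nth l0 v i).
  by move=> si; rewrite ev (nth_map l0).
have eqn i k : i < size v -> k < size v -> (nth l0 v i == nth l0 v k) = (i == k).
  by move=> si sk; rewrite nth_uniq.
case: left @x => x.
  pose Y := slid_CG_set cv (b := true) dv; exists Y; split.
    exists X, Y; split=> //; exists j.+1; left; split; first exact: jN.
    rewrite (slid_chord_ends_flatten cv (b := true) dv l0) /slide_left.
    rewrite sc; congr flatten; apply/eq_in_map => i.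
    rewrite mem_iota /= add0n => si.
    rewrite !eqn // -/a -/b ea eb nthc // -letter_eval_inv (inj_eq injX).
    by rewrite /slid_letter; case: eqP => // ->; rewrite letter_eval_inv.
  move=> E; have := sum_chord_ends_slid cv (b := true) dv E.
  by rewrite /slid_letter -ea -eb.
have dv' : v = take j v ++ (if false then [:: m; l] else [:: l; m]) ++ drop j.+2 v by [].
pose Y := slid_CG_set cv (l := m) (m := l) (b := false) dv'; exists Y; split.
  exists X, Y; split=> //; exists j; right; split; first exact: jN.
  rewrite (slid_chord_ends_flatten cv (l := m) (m := l) (b := false) dv' l0) /slide_right.
  rewrite sc; congr flatten; apply/eq_in_map => i.
  rewrite mem_iota /= add0n => si.
  by rewrite !eqn // -/a -/b ea eb nthc // -letter_eval_inv (inj_eq injX).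
move=> E; have := sum_chord_ends_slid cv (l := m) (m := l) (b := false) dv' E.
by rewrite /slid_letter -ea -eb.
Qed.

(** * Energy of words *)

(** Sizes are abstracted before calling [lia], which does not identify terms that
    differ only in how the letter type is inferred. *)
Ltac lia_sizes :=
  repeat match goal with |- context [@size ?T ?s] =>
    let n := fresh in move: (@size T s) => n end; lia.

Section WordEnergy.
Local Open Scope nat_scope.
Variables (T : choiceType) (N : nat) (rk : T * bool -> nat).
Hypothesis rk_lt : forall l, rk l < N.
Hypothesis rk_inj : injective rk.
Implicit Types (l : T * bool) (u v w p q a : seq (T * bool)).

(** The digits run from 1 to [N] in base [N.+1]; the digit 0 is avoided so that
    longer words have larger energy. *)
Definition word_energy w := foldl (fun e l => e * N.+1 + (rk l).+1) 0 w.
Local Notation E := word_energy.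

(** A chord contributes its two ends, which are mutually inverse. *)
Definition sym_energy w := E w + E (word_inv w).

Lemma word_energy_cat u v : E (u ++ v) = E u * N.+1 ^ size v + E v.
Proof.
elim/last_ind: v => [|v l IH]; first by rewrite cats0 expn0 muln1 addn0.
rewrite -rcons_cat /E !foldl_rcons -!/(E _) IH size_rcons expnS.
by rewrite mulnDl -mulnA [N.+1 * _]mulnC addnA.
Qed.

Lemma word_energy_rcons u l : E (rcons u l) = E u * N.+1 + (rk l).+1.
Proof. by rewrite /E foldl_rcons. Qed.

Lemma word_energy_lt w : E w < N.+1 ^ size w.
Proof.
elim/last_ind: w => [|w l IH]; first by rewrite expn0.
rewrite word_energy_rcons size_rcons expnS.
have := rk_lt l; move: (rk l) (N.+1 ^ _) IH => k M; nia.
Qed.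

Lemma word_energy_ge l w : N.+1 ^ size w <= E (l :: w).
Proof.
rewrite -cat1s word_energy_cat {1}/E /= mul0n add0n.
by rewrite mulSn -addnA leq_addr.
Qed.

Lemma word_energy_inj u v : size u = size v -> E u = E v -> u = v.
Proof.
elim/last_ind: u v => [|u l IH] v; first by case: v.
case/lastP: v => [|v m]; first by rewrite size_rcons.
rewrite !size_rcons !word_energy_rcons => -[suv] e.
have [rl rm] := (rk_lt l, rk_lt m).
have euv : E u = E v by move: (E u) (E v) (rk l) (rk m) e rl rm => * ; nia.
by rewrite (IH v) //; congr rcons; apply: rk_inj; move: e; rewrite euv; lia.
Qed.

Lemma word_energy_size_lt u v : size u < size v -> E u < E v.
Proof.
case: v => [//|l v] /= suv.
apply: leq_trans (word_energy_lt u) (leq_trans _ (word_energy_ge l v)).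
by rewrite leq_pexp2l.
Qed.

Lemma sym_energyV w : sym_energy (word_inv w) = sym_energy w.
Proof. by rewrite /sym_energy word_invK addnC. Qed.

Lemma sym_energy_size u v : sym_energy u <= sym_energy v -> size u <= size v.
Proof.
move=> le; rewrite leqNgt; apply/negP => svu; move: le; apply/negP.
rewrite -ltnNge /sym_energy; have := word_energy_size_lt svu.
have : E (word_inv v) < E (word_inv u).
  by apply: word_energy_size_lt; rewrite !size_word_inv.
lia.
Qed.

(** In [p ++ a] the prefix [p] holds the most significant digits, while in the
    inverse word it occupies the [size p <= size a] least significant ones, so
    the first effect dominates. *)
Lemma sym_energy_prefix p q a : size p = size q -> size p <= size a ->
  sym_energy (p ++ a) <= sym_energy (q ++ a) -> E p <= E q.
Proof.
move=> spq spa le; rewrite leqNgt; apply/negP => Eqp; move: le; apply/negP.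
rewrite -ltnNge /sym_energy !word_inv_cat !word_energy_cat !size_word_inv spq.
have := word_energy_lt (word_inv q); rewrite size_word_inv.
have : N.+1 ^ size q <= N.+1 ^ size a by rewrite leq_pexp2l // -spq.
move: (E p) (E q) (E a) (E (word_inv a)) (E (word_inv p)) (E (word_inv q)) Eqp.
move: (N.+1 ^ size a) (N.+1 ^ size q) => M K ep eq ea ea' ep' eq' H1 H2 H3.
have : eq * M + M <= ep * M by rewrite -mulSnr leq_mul2r H1 orbT.
lia.
Qed.

End WordEnergy.

Lemma reduced_cat_overlap (T : choiceType) (u v w : seq (T * bool)) :
  v != [::] -> reduced (u ++ v) -> reduced (v ++ w) -> reduced (u ++ v ++ w).
Proof.
case: v => // x v _ ruv rvw; rewrite /=; apply: reduced_cat_middle => //.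
by move: ruv; rewrite -cat_rcons => /reduced_catl.
Qed.

Lemma flatten_singletons (A : eqType) (ms : seq (seq A)) :
  all (fun m => m != [::]) ms -> size (flatten ms) <= size ms ->
  ms = [seq [:: x] | x <- flatten ms].
Proof.
have sz (ns : seq (seq A)) : all (fun m => m != [::]) ns -> size ns <= size (flatten ns).
  elim: ns => //= n ns IH /andP[n0 /IH]; rewrite size_cat.
  by case: n n0 => //= *; lia.
elim: ms => //= m ms IH /andP[m0 ams]; rewrite size_cat => le.
have := sz _ ams; case: m m0 le => // x [|y m] _ /= le le'; last by lia.
by rewrite -IH.
Qed.

(** * Diagrams without energy decreasing slides *)

Section LocalMinimum.
Local Open Scope nat_scope.
Variables (g : nat) (S : CG_set g) (vS : seq ('I_(2 * g) * bool)).
Hypothesis cvS : chord_word S vS.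
Variable l0 : 'I_(2 * g) * bool.

Local Notation L := ('I_(2 * g) * bool)%type.
Local Notation N := (4 * g).
Let rk (l : L) := index l vS.
Let E := word_energy N rk.
Let E2 := sym_energy N rk.

Variable c : nat -> seq L.
Hypothesis c_red : forall i, reduced (c i).
Hypothesis c_neq0 : forall i, i < N -> c i != [::].
Hypothesis c_inv : forall i, i < N -> exists2 k, k < N & c k = word_inv (c i).
Hypothesis c_prod : word_eval S (flatten (map c (iota 0 N))) = word_eval S vS.
Hypothesis c_min : forall i a p b, i.+1 < N ->
  c i = a ++ word_inv p -> c i.+1 = p ++ b -> reduced (a ++ b) ->
  E2 (c i) <= E2 (a ++ b) /\ E2 (c i.+1) <= E2 (a ++ b).

Let rk_lt l : rk l < N.
Proof. by rewrite -(size_chord_word cvS) index_mem (chord_word_mem _ cvS). Qed.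

Let rk_inj : injective rk.
Proof.
move=> l m e; rewrite -(nth_index l0 (chord_word_mem l cvS)).
by rewrite -[LHS]/(nth l0 vS (rk l)) e /rk nth_index // (chord_word_mem _ cvS).
Qed.

Let trivial_eq0 w : reduced w -> word_eval S w = 1%g -> w = [::].
Proof. exact: (generators_free (card_surface_gens g) (@cg_generates _ S)). Qed.

(** The part of [c i] that cancels against its left neighbour, with the convention
    that nothing is cancelled at both ends of the sequence. *)
Definition cancelled i : seq L :=
  if i is j.+1 then
    if j.+1 < N then sval (cancel_decomp (c_red j) (c_red j.+1)) else [::]
  else [::].
Local Notation p := cancelled.

Lemma cancelledP i : i.+1 < N -> exists a b,
  [/\ c i = a ++ word_inv (p i.+1), c i.+1 = p i.+1 ++ b & reduced (a ++ b)].
Proof. by move=> iN; rewrite /cancelled iN; case: (cancel_decomp _ _). Qed.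

Lemma cancelled_last : p N = [::].
Proof. by rewrite /cancelled; case: (N) => // n; rewrite ltnn. Qed.

(** Otherwise the product would be shorter than one of its factors, and replacing
    this factor by the product would decrease the energy. *)
Lemma cancelled_half i : i.+1 < N ->
  2 * size (p i.+1) <= size (c i) /\ 2 * size (p i.+1) <= size (c i.+1).
Proof.
move=> iN; have [a [b [ea eb rab]]] := cancelledP iN.
have [/(sym_energy_size rk_lt) + /(sym_energy_size rk_lt)] := c_min iN ea eb rab.
by rewrite ea eb !size_cat size_word_inv; lia_sizes.
Qed.

Lemma cancelled_right i : i < N ->
  (exists a, c i = a ++ word_inv (p i.+1)) /\ 2 * size (p i.+1) <= size (c i).
Proof.
move=> iN; have [iN1|] := ltnP i.+1 N.
  have [a [b [ea _ _]]] := cancelledP iN1.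
  by have [? _] := cancelled_half iN1; split; [exists a|].
move=> Ni; have -> : i.+1 = N by lia.
by rewrite cancelled_last; split=> //; exists (c i); rewrite cats0.
Qed.

Lemma cancelled_left i : i < N ->
  (exists b, c i = p i ++ b) /\ 2 * size (p i) <= size (c i).
Proof.
case: i => [|i] iN; first by split=> //; exists (c 0).
have [a [b [_ eb _]]] := cancelledP iN.
by have [_ ?] := cancelled_half iN; split; [exists b|].
Qed.

Definition middle i := drop (size (p i)) (take (size (c i) - size (p i.+1)) (c i)).

Lemma middleP i : i < N -> c i = p i ++ middle i ++ word_inv (p i.+1).
Proof.
move=> iN; have [[a ea] sa] := cancelled_right iN; have [[b eb] sb] := cancelled_left iN.
have et : take (size (c i) - size (p i.+1)) (c i) = a.
  by rewrite ea size_cat size_word_inv addnK take_size_cat.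
rewrite /middle et catA; suff -> : p i ++ drop (size (p i)) a = a by [].
rewrite -[RHS](cat_take_drop (size (p i))); congr (_ ++ _).
have : take (size (p i)) (c i) = p i by rewrite eb take_size_cat.
have sap : size (p i) <= size a.
  by move: sa sb; rewrite ea size_cat size_word_inv; lia_sizes.
rewrite ea take_cat; case: ltnP => // le.
have -> : size (p i) - size a = 0 by apply/eqP.
by rewrite take0 cats0 take_oversize.
Qed.

(** The right neighbour of [c i] starts with [p i.+1], and the product of the two
    starts with [q] instead; minimality compares these two words. *)
Lemma exchange_right i q : i < N ->
  c i = q ++ word_inv (p i.+1) -> size q = size (p i.+1) -> E (p i.+1) <= E q.
Proof.
move=> iN ec sq; have [iN1|Ni] := ltnP i.+1 N; last first.
  have -> : i.+1 = N by lia.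
  by rewrite cancelled_last.
have [a [b [ea eb rab]]] := cancelledP iN1.
have eaq : a = q.
  move: (ea); rewrite ec => /eqP; rewrite eqseq_cat.
    by rewrite eqxx andbT eq_sym => /eqP.
  by move/eqP: (congr1 size ea); rewrite ec !size_cat eqn_add2r => /eqP.
have [_] := c_min iN1 ea eb rab; rewrite eaq eb.
apply: (sym_energy_prefix rk_lt) => //.
by have [_] := cancelled_half iN1; rewrite eb size_cat; lia_sizes.
Qed.

(** The mirror image, for the left neighbour of [c i]. *)
Lemma exchange_left i q : i < N ->
  c i = p i ++ word_inv q -> size q = size (p i) -> E (p i) <= E q.
Proof.
case: i => [|i] iN ec sq; first by [].
have [a [b [ea eb rab]]] := cancelledP iN.
have ebq : b = word_inv q.
  by move: (eb); rewrite ec => /eqP; rewrite eqseq_cat // eqxx eq_sym => /eqP.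
have [+ _] := c_min iN ea eb rab.
rewrite ebq ea /E2 -sym_energyV -[X in _ <= X]sym_energyV !word_inv_cat !word_invK.
apply: (sym_energy_prefix rk_lt) => //.
by have [+ _] := cancelled_half iN; rewrite ea size_cat !size_word_inv; lia_sizes.
Qed.

Lemma no_antipalindrome i q : i < N -> c i <> q ++ word_inv q.
Proof.
move=> iN ec; move: (c_neq0 iN); rewrite (trivial_eq0 (c_red i)) //.
by rewrite ec word_eval_cat word_eval_inv mulgV.
Qed.

(** With an empty middle the two exchange inequalities give [p i = p i.+1], and
    [c i] would be trivial. *)
Lemma middle_neq0 i : i < N -> middle i != [::].
Proof.
move=> iN; apply/eqP => m0; have ec := middleP iN; rewrite m0 /= in ec.
have [_ sr] := cancelled_right iN; have [_ sl] := cancelled_left iN.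
have spq : size (p i) = size (p i.+1).
  by move: sr sl; rewrite ec size_cat size_word_inv; lia_sizes.
have le1 := exchange_right iN ec spq.
have le2 := exchange_left iN ec (esym spq).
have epq : p i = p i.+1.
  by apply: (word_energy_inj rk_lt rk_inj spq); apply/eqP; rewrite eqn_leq le1 le2.
by apply: (@no_antipalindrome i (p i)) => //; rewrite {2}epq.
Qed.

Lemma middle_reduced n i : i + n <= N -> reduced (flatten (map middle (iota i n))).
Proof.
elim: n i => [//|n IH] i inN.
case: n IH inN => [|n] IH inN.
  rewrite /= cats0; have := c_red i; rewrite middleP ?catA; last by lia.
  by rewrite -catA => /reduced_catr /reduced_catl.
have iN : i.+1 < N by lia.
have [a [b [ea eb]]] := cancelledP iN.
have ea' : a = p i ++ middle i.
  apply/eqP; have := ea; rewrite (middleP (ltnW iN)) catA => /eqP.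
  rewrite eqseq_cat; first by rewrite eqxx andbT eq_sym.
  have := congr1 size ea; rewrite (middleP (ltnW iN)) catA !size_cat => /eqP.
  by rewrite eqn_add2r => /eqP.
have eb' : b = middle i.+1 ++ word_inv (p i.+2).
  apply/eqP; have := eb; rewrite (middleP iN) => /eqP.
  by rewrite eqseq_cat // eqxx eq_sym.
rewrite ea' eb' -!catA => /reduced_catr; rewrite catA => /reduced_catl rmm.
have := IH i.+1; rewrite addSnnS => /(_ inN) rest.
exact: reduced_cat_overlap (middle_neq0 iN) rmm rest.
Qed.

Lemma middle_prod k : k <= N ->
  word_eval S (flatten (map c (iota 0 k))) =
  (word_eval S (flatten (map middle (iota 0 k))) * word_eval S (word_inv (p k)))%g.
Proof.
elim: k => [|k IH] kN; first by rewrite /word_eval /= big_nil mulg1.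
have -> : iota 0 k.+1 = rcons (iota 0 k) k by rewrite -[k.+1]addn1 iotaD cats1.
rewrite !map_rcons !flatten_rcons !word_eval_cat IH ?(ltnW kN) //.
rewrite (middleP kN) !word_eval_cat !mulgA; congr (_ * _ * _)%g.
by rewrite word_eval_inv mulgKV.
Qed.

(** The [4 * g] nonempty middles concatenate to the word [vS] of length
    [4 * g]. *)
Lemma middle_letter i : i < N -> middle i = [:: nth l0 vS i].
Proof.
have em : flatten (map middle (iota 0 N)) = vS.
  apply: (reduced_word_inj (card_surface_gens g) (@cg_generates _ S)).
  - exact: middle_reduced.
  - exact: (chord_word_reduced (@cg_generates _ S)).
  have := middle_prod (leqnn _); rewrite c_prod cancelled_last => ->.
  by rewrite /word_eval big_nil mulg1.
have es : map middle (iota 0 N) = [seq [:: x] | x <- vS].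
  rewrite -[in RHS]em; apply: flatten_singletons.
    by apply/allP => m /mapP[j]; rewrite mem_iota /= add0n => /middle_neq0 mj ->.
  by rewrite em size_map size_iota (size_chord_word cvS).
move=> iN; have := congr1 (fun s => nth [::] s i) es.
rewrite (nth_map 0) ?size_iota // nth_iota // add0n => ->.
by rewrite (nth_map l0) // (size_chord_word cvS).
Qed.

Local Notation sigma i := (nth l0 vS i).

Lemma conjugated_letter i : i < N -> c i = p i ++ sigma i :: word_inv (p i.+1).
Proof. by move=> iN; rewrite {1}(middleP iN) middle_letter. Qed.

Lemma step_size i : i < N ->
  size (p i) <= (size (p i.+1)).+1 /\ size (p i.+1) <= (size (p i)).+1.
Proof.
move=> iN; have [_ sr] := cancelled_right iN; have [_ sl] := cancelled_left iN.
by move: sr sl; rewrite conjugated_letter // size_cat /= size_word_inv; lia_sizes.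
Qed.

Lemma step_up i : i < N -> size (p i.+1) = (size (p i)).+1 ->
  E (p i.+1) < E (rcons (p i) (sigma i)).
Proof.
move=> iN sp; have ec : c i = rcons (p i) (sigma i) ++ word_inv (p i.+1).
  by rewrite cat_rcons conjugated_letter.
have sz : size (rcons (p i) (sigma i)) = size (p i.+1) by rewrite size_rcons sp.
rewrite ltn_neqAle (exchange_right iN ec sz) andbT; apply/eqP => eE.
apply: (@no_antipalindrome i (p i.+1)) => //.
by rewrite {1}(word_energy_inj rk_lt rk_inj (esym sz) eE).
Qed.

Lemma step_down i : i < N -> size (p i) = (size (p i.+1)).+1 ->
  E (p i) < E (rcons (p i.+1) (letter_inv (sigma i))).
Proof.
move=> iN sp.
have ec : c i = p i ++ word_inv (rcons (p i.+1) (letter_inv (sigma i))).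
  by rewrite word_inv_rcons letter_invK conjugated_letter.
have sz : size (rcons (p i.+1) (letter_inv (sigma i))) = size (p i) by rewrite size_rcons sp.
rewrite ltn_neqAle (exchange_left iN ec sz) andbT; apply/eqP => eE.
apply: (@no_antipalindrome i (p i)) => //.
by rewrite {2}(word_energy_inj rk_lt rk_inj (esym sz) eE).
Qed.

(** The sizes of [p k] and [p k.+1] are those of [p i.+1] and [p i], in this order
    or swapped.  In the first case the two expressions of [c k] can be compared
    letter by letter.  In the swapped case, if the sizes differ, [c i] and [c k]
    make a step in the same direction, and their strict inequalities contradict
    each other. *)
Lemma paired_steps i k : i < N -> k < N -> c k = word_inv (c i) ->
  sigma k = letter_inv (sigma i) /\ p k = p i.+1.
Proof.
move=> iN kN; rewrite !conjugated_letter // word_inv_cat word_inv_cons word_invK cat_rcons => e.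
have [i1 i2] := step_size iN; have [k1 k2] := step_size kN.
have := congr1 size e; rewrite !size_cat /= !size_word_inv => se.
have [spk|spk] := eqVneq (size (p k)) (size (p i.+1)).
  by move/eqP: e; rewrite eqseq_cat // => /andP[/eqP-> /eqP[-> _]].
have [ski ski1] : size (p k) = size (p i) /\ size (p k.+1) = size (p i.+1).
  by move: spk i1 i2 k1 k2 se; lia_sizes.
have [up|down] : size (p i.+1) = (size (p i)).+1 \/ size (p i) = (size (p i.+1)).+1.
  by move: spk i1 i2 ski ski1; lia_sizes.
- have e1 : rcons (p k) (sigma k) = p i.+1 /\
            word_inv (p k.+1) = letter_inv (sigma i) :: word_inv (p i).
    move/eqP: e; rewrite -cat_rcons eqseq_cat; last by rewrite size_rcons ski up.
    by move=> /andP[/eqP-> /eqP->].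
  have e2 : p k.+1 = rcons (p i) (sigma i).
    by rewrite -[LHS]word_invK e1.2 word_inv_cons word_invK letter_invK.
  have := step_up iN up; have := @step_up k kN; rewrite e1.1 -e2.
  by rewrite ski ski1 up => /(_ erefl) H1 H2; have := ltn_trans H1 H2; rewrite ltnn.
- have e1 : p k = rcons (p i.+1) (letter_inv (sigma i)) /\
            sigma k :: word_inv (p k.+1) = word_inv (p i).
    move/eqP: e; rewrite -[X in _ == X]cat_rcons eqseq_cat; last by rewrite size_rcons ski down.
    by move=> /andP[/eqP-> /eqP->].
  have e2 : p i = rcons (p k.+1) (letter_inv (sigma k)).
    by rewrite -[LHS]word_invK -e1.2 word_inv_cons word_invK.
  have := step_down iN down; have := @step_down k kN; rewrite -e1.1 -e2.
  by rewrite ski ski1 down => /(_ erefl) H1 H2; have := ltn_trans H1 H2; rewrite ltnn.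
Qed.

Theorem local_minimum i : i < N -> c i = [:: sigma i].
Proof.
have p0 j : j <= N -> (p j != [::]) = false.
  apply: (one_vertex (l0 := l0) (f := fun j => p j != [::]) (@cg_generates _ S) cvS).
  - by [].
  - by rewrite cancelled_last.
  move=> a k aN kN eka; have [k' kN' ek'] := c_inv aN.
  have [es ep] := paired_steps aN kN' ek'.
  suff -> : k = k' by rewrite ep.
  apply: (nth_uniq_inj (x0 := l0) (chord_word_uniq cvS)).
  - by rewrite (size_chord_word cvS).
  - by rewrite (size_chord_word cvS).
  by rewrite eka es.
move=> iN; rewrite conjugated_letter //.
by move/negbFE/eqP: (p0 _ (ltnW iN)) => ->; move/negbFE/eqP: (p0 _ iN) => ->.
Qed.

End LocalMinimum.

(** * Energy descent *)

Section NormalForm.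
Variables (g : nat) (S : CG_set g) (vS : seq ('I_(2 * g) * bool)).
Hypothesis cvS : chord_word S vS.
Variable l0 : 'I_(2 * g) * bool.
Local Notation N := (4 * g)%N.
Implicit Types (x y : surface_group g) (w : seq ('I_(2 * g) * bool)).

Definition normal_form x := [seq nth l0 vS (val j) | j <- reduced_word S x].

Let tnth_chord_end (j : 'I_(4 * g)) :
  tnth (chord_ends S) j = letter_eval S (nth l0 vS j).
Proof.
rewrite (tnth_nth 1) (chord_ends_eq cvS) (nth_map l0) //.
by rewrite (size_chord_word cvS).
Qed.

Lemma normal_form_reduced x : reduced (normal_form x).
Proof.
have /andP[rs _] := xchooseP (reduced_word_exists S x).
rewrite /reduced /normal_form sorted_map; apply: sub_sorted rs => j k.
by rewrite !tnth_chord_end -letter_eval_inv (inj_eq (letter_eval_inj (@cg_generates _ S))).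
Qed.

Lemma word_eval_normal_form x : word_eval S (normal_form x) = x.
Proof.
have /andP[_ /eqP es] := xchooseP (reduced_word_exists S x).
by rewrite -[RHS]es /word_eval big_map; apply: eq_bigr => j _; rewrite tnth_chord_end.
Qed.

Lemma normal_form_eq w : reduced w -> normal_form (word_eval S w) = w.
Proof.
move=> rw; apply: (reduced_word_inj (card_surface_gens g) (@cg_generates _ S)) => //.
  exact: normal_form_reduced.
exact: word_eval_normal_form.
Qed.

Lemma normal_formV x : normal_form x^-1 = word_inv (normal_form x).
Proof.
rewrite -[in LHS](word_eval_normal_form x) -word_eval_inv normal_form_eq //.
exact/reduced_word_inv/normal_form_reduced.
Qed.

(** The two definitions of energy read the same digits, the index of a letter in
    [vS] being its position among the chord ends of [S]. *)
Lemma energy_normal_form x :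
  energy S x = word_energy N (index^~ vS) (normal_form x).
Proof.
rewrite /energy /normal_form /word_energy; move: (reduced_word S x) => s.
elim/last_ind: s => [|s j IH]; first by rewrite big_ord0.
have jv : val j < size vS by rewrite (size_chord_word cvS) ltn_ord.
rewrite map_rcons foldl_rcons -IH index_uniq ?(chord_word_uniq cvS) //.
have tn (r : seq 'I_N) (i : 'I_(size r)) : tnth (in_tuple r) i = nth j r i.
  by rewrite (tnth_nth j).
under eq_bigr do rewrite tn; under [in RHS]eq_bigr do rewrite tn.
rewrite -(big_mkord xpredT (fun i =>
  (4 * g + 1) ^ (size (rcons s j) - i.+1) * (nth j (rcons s j) i).+1))%N.
rewrite -(big_mkord xpredT (fun i => (4 * g + 1) ^ (size s - i.+1) * (nth j s i).+1))%N.
rewrite size_rcons big_nat_recr //= nth_rcons ltnn eqxx subnn expn0 mul1n.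
congr (_ + _)%N; rewrite big_distrl /=; apply: eq_big_nat => i /andP[_ iN].
by rewrite nth_rcons iN subSn // expnS addn1 -mulnA mulnC.
Qed.

Lemma energy_pair x :
  (energy S x + energy S x^-1)%N = sym_energy N (index^~ vS) (normal_form x).
Proof. by rewrite !energy_normal_form normal_formV. Qed.

End NormalForm.

Lemma diagram_energyE g (S X : CG_set g) :
  diagram_energy S (diagram X) = (\sum_(c <- chord_ends X) energy S c)%N.
Proof. by rewrite /diagram_energy [RHS]big_tuple. Qed.

Lemma chord_end_neq1 g (X : CG_set g) x : x \in chord_ends X -> x != 1.
Proof.
rewrite (perm_mem (chord_ends_perm X)) => /mapP[l _ ->]; apply/eqP => e1.
suff: [:: l] = [::] by [].
apply: (generators_free (card_surface_gens g) (@cg_generates _ X)) => //.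
by rewrite word_eval1.
Qed.

Lemma chord_ends_inv g (X : CG_set g) x : x \in chord_ends X -> x^-1 \in chord_ends X.
Proof.
rewrite !(perm_mem (chord_ends_perm X)) => /mapP[l _ ->].
by rewrite -letter_eval_inv; apply: map_f; rewrite mem_enum.
Qed.

Lemma energy_descent g (S X : CG_set g) : chord_ends X != chord_ends S ->
  exists Y : CG_set g, chord_slide (diagram X) (diagram Y) /\
    diagram_energy S (diagram Y) < diagram_energy S (diagram X).
Proof.
move=> neXS; have [vS cvS evS] := chord_ends_word S.
pose e2 x := (energy S x + energy S x^-1)%N.
pose cX := nth 1 (chord_ends X).
pose slide_raises (left : bool) i :=
  e2 (if left then cX i else cX i.+1) <= e2 (cX i * cX i.+1).
have [/forallP up|] := boolP [forall i : 'I_(4 * g), forall left : bool,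
    (i.+1 < 4 * g)%N ==> slide_raises left i]; last first.
  case/forallPn => i /forallPn[left]; rewrite negb_imply => /andP[iN].
  rewrite /slide_raises -ltnNge => lt.
  have [Y [sXY eXY]] := slide_exists X left iN; exists Y; split=> //.
  rewrite !diagram_energyE; have := eXY (energy S); move: lt.
  rewrite /e2 /cX; case: left {eXY}; lia.
case/eqP: neXS; apply/val_inj => /=.
have sX : size (chord_ends X) = (4 * g)%N by rewrite size_tuple.
have sS : size (chord_ends S) = (4 * g)%N by rewrite size_tuple.
apply: (@eq_from_nth _ 1); first by rewrite sX sS.
move=> i0; rewrite sX => i0N.
have [l0 _] : {l0 : 'I_(2 * g) * bool | true}.
  by case: (vS) (size_chord_word cvS) i0N => [<-//|l0 ? _ _]; exists l0.
have memX i : i < (4 * g)%N -> cX i \in chord_ends X.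
  by move=> iN; rewrite mem_nth // sX.
pose nf := normal_form S vS l0.
have nfK x : word_eval S (nf x) = x by exact: word_eval_normal_form.
have loc : nf (cX i0) = [:: nth l0 vS i0].
  apply: (local_minimum cvS l0 (c := fun i => nf (cX i))) => //.
  - by move=> i; exact: normal_form_reduced.
  - move=> i iN; apply: contraNneq (chord_end_neq1 (memX i iN)) => nf0.
    by rewrite -(nfK (cX i)) nf0 /word_eval big_nil.
  - move=> i iN; have /(nthP 1)[k kN ek] := chord_ends_inv (memX i iN).
    rewrite sX in kN; exists k => //.
    by rewrite /cX ek; exact: normal_formV.
  - have -> : word_eval S vS = \prod_(x <- chord_ends X) x.
      by case: cvS => _ ->; have /andP[_ /eqP->] := xchooseP (chord_ends_exist X).
    rewrite -(mkseq_nth 1 (chord_ends X)) sX /mkseq.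
    elim: (iota _ _) => [|i s IH]; first by rewrite /word_eval !big_nil.
    by rewrite /= word_eval_cat IH nfK big_cons.
  move=> i a p b iN ea eb rab.
  have eab : a ++ b = nf (cX i * cX i.+1).
    rewrite -[LHS](normal_form_eq cvS l0 rab); congr nf.
    rewrite -(nfK (cX i)) -(nfK (cX i.+1)) ea eb !word_eval_cat word_eval_inv.
    by rewrite !mulgA mulgKV.
  have /forallP raises := up (Ordinal (ltnW iN)).
  rewrite eab -!(energy_pair cvS l0); split.
    exact: (implyP (raises true) iN).
  exact: (implyP (raises false) iN).
rewrite -/(cX i0) -(nfK (cX i0)) loc word_eval1 evS (nth_map l0) //.
by rewrite (size_chord_word cvS).
Qed.

Lemma diagram_eq g (X Y : CG_set g) : chord_ends X = chord_ends Y -> diagram X = diagram Y.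
Proof. by rewrite /diagram => ->. Qed.

Local Close Scope group_scope.

Theorem theorem1p1 (g : nat) (hg : 1 <= g) (S X : CG_set g) :
  exists (k : nat) (G : nat -> marked_diagram g),
    [/\ G 0 = diagram X,
        forall i, i < k -> chord_slide (G i) (G i.+1),
        forall i, i < k -> diagram_energy S (G i.+1) < diagram_energy S (G i)
      & G k = diagram S].
Proof.
have [n] := ubnP (diagram_energy S (diagram X)); elim: n X => // n IH X leXn.
have [eXS|neXS] := eqVneq (chord_ends X) (chord_ends S).
  by exists 0, (fun=> diagram X); split=> //; apply: diagram_eq.
have [Y [slideXY ltYX]] := energy_descent neXS.
have [|k [G [G0 slideG ltG Gk]]] := IH Y; first exact: leq_trans ltYX leXn.
exists k.+1, (fun i => if i is j.+1 then G j else diagram X).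
split=> // [[|i]|[|i]]; rewrite ?G0 // ltnS; [exact: slideG | exact: ltG].
Qed.
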